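(* Let $n\ge 3$, let $A\in\mathbb{R}^{n\times n}$, and let $L:\mathbb{R}^{n\times n}\to\mathbb{R}^2$ be a linear map. Then $L(O(A))=\{L(B):B\in O(A)\}$ is star-shaped with respect to the origin.
   Context: $\mathrm{SO}_n=\{U\in\mathbb{R}^{n\times n}:U^tU=UU^t=I_n,\ \det U>0\}$ is the set of $n\times n$ special orthogonal matrices. For $A\in\mathbb{R}^{n\times n}$, the special orthogonal orbit of $A$ is $O(A)=\{UAV:U,V\in\mathrm{SO}_n\}$. A set $S$ in a real vector space is star-shaped with respect to $c\in S$ if $\alpha x+(1-\alpha)c\in S$ for all $0\le\alpha\le 1$ and all $x\in S$ (in particular $c\in S$). *)

(* Defs.v *)
From mathcomp Require Import all_boot all_order all_algebra.
From mathcomp Require Import classical_sets reals.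

Set Implicit Arguments.
Unset Strict Implicit.
Unset Printing Implicit Defensive.

Import Order.TTheory GRing.Theory Num.Theory.

Local Open Scope classical_set_scope.
Local Open Scope ring_scope.

Definition SO (R : realType) (n : nat) : set 'M[R]_n :=
  [set U | [/\ U^T *m U = 1%:M, U *m U^T = 1%:M & 0 < \det U]].

Definition so_orbit (R : realType) (n : nat) (A : 'M[R]_n) : set 'M[R]_n :=
  [set U *m A *m V | U in @SO R n & V in @SO R n].

Definition star_shaped (R : realType) (V : lmodType R) (S : set V) (c : V) :
    Prop :=
  S c /\ forall (a : R) (x : V), 0 <= a <= 1 -> S x ->
    S (a *: x + (1 - a) *: c).

(* Main.v *)
From HB Require Import structures.
Require Import Defs.
From mathcomp Require Import all_boot all_order all_algebra.
From mathcomp Require Import classical_sets reals.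
From mathcomp Require Import ring lra.

Set Implicit Arguments.
Unset Strict Implicit.
Unset Printing Implicit Defensive.

Import Order.TTheory GRing.Theory Num.Theory.

Local Open Scope classical_set_scope.
Local Open Scope ring_scope.

(** Write C(n) for the claim that, for every linear [L] from n x n matrices to
the plane and every [a] in [0, 1], some rotation [U] satisfies
[L U = a *: L 1]. Applying C(n) to [X |-> L (X *m B)] with [B] in the orbit of
[A] gives a rotation [W] with [L (W *m B) = a *: L B], and [W *m B] is again in
the orbit; so C(n) says at once that the image contains the origin and is
star-shaped about it. What remains is to prove C(n) for n >= 3.

Block diagonal rotations show that C(m) and C(n) imply C(m + n)
([shrinksD]), which leaves n = 3, 4, 5.

A complex structure [J], i.e. a skew [J] with [J *m J = -1], gives rotations
[a + s J]. If [L J = 0], such a rotation has image [a *: L 1]. For n = 4 the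
imaginary quaternions, acting by left multiplication, form a 3-dimensional
space whose unit vectors are complex structures, and [L] kills one of them
because its target has dimension 2. For n = 5 the same count finds a plane whose
quarter turn, extended by zero, is killed by [L]; after an orthogonal change of
basis, this plane is one block and C(3) handles the other.

For n = 3 rotations are parametrised by quadratic forms in a quaternion [q]
with 4 real coordinates. With [v = L 1], the equation [L U = a *: v] becomes
the vanishing at a nonzero [q] of two quadratic forms: [G], the component of
[L (rot q q)] orthogonal to [v], and [H], the component along [v] minus its
intended value. The unit quaternion 1 has [G = 0] and [H >= 0]. The half turns
about the three axes and the identity add up to zero, so over the three
imaginary units [G] sums to 0 and [H] to a negative number, and [quadratic_sum]
turns the three units into a single vector with [G = 0] and [H < 0]. Finally
[quadratic_common_zero] joins the two vectors inside the cone [G = 0] by an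
explicit polynomial path, on which [H] vanishes somewhere. Three dimensions are
needed for that path, as in the theorems of Calabi and Brickman on pairs of
real quadratic forms. *)

(** * Pairs of real quadratic forms *)

Lemma exists_kernel (F : fieldType) m k (f : 'rV[F]_m -> 'rV[F]_k) :
  linear f -> (k < m)%N -> exists2 w, w != 0 & f w = 0.
Proof.
move=> flin ltkm.
pose g := HB.pack_for {linear 'rV[F]_m -> 'rV[F]_k} f
  (GRing.isLinear.Build F _ _ _ f flin).
have : kermx (lin1_mx g) != 0.
  rewrite -mxrank_eq0 mxrank_ker subn_eq0 -ltnNge.
  exact: leq_ltn_trans (rank_leq_col _) ltkm.
case/rowV0Pn=> w /sub_kermxP; rewrite mul_rV_lin1 => gw w0.
by exists w.
Qed.

Section Forms.
Variable R : rcfType.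

(** Quadratic forms are handled through their polar forms: the form attached to
[b] is [x |-> b x x]. *)
Definition symmetric_bilinear (V : lmodType R) (b : V -> V -> R) :=
  (forall x y, b x y = b y x) /\
  (forall c x y z, b (c *: x + y) z = c * b x z + b y z).

Lemma symbil0 (V : lmodType R) (b : V -> V -> R) (u : V) :
  symmetric_bilinear b -> b 0 u = 0.
Proof.
by case=> _ bl; have := bl 1 0 0 u; rewrite scaler0 addr0 mul1r => /eqP; lra.
Qed.

Lemma symbil_lin (V : lmodType R) (b : V -> V -> R) (c d e : R) (x y w u : V) :
  symmetric_bilinear b ->
  b (c *: x + (d *: y + e *: w)) u = c * b x u + d * b y u + e * b w u.
Proof.
by move=> bs; case: (bs) => _ bl; rewrite !bl -[e *: w]addr0 bl symbil0 //; ring.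
Qed.

Lemma symbil_comb (V : lmodType R) (b : V -> V -> R) (c d e : R) (x y w : V) :
  symmetric_bilinear b ->
  let z := c *: x + (d *: y + e *: w) in
  b z z = c ^+ 2 * b x x + d ^+ 2 * b y y + e ^+ 2 * b w w
          + 2 * (c * d * b x y + c * e * b x w + d * e * b y w).
Proof.
move=> bs z; have bC := proj1 bs; have bz u := symbil_lin c d e x y w u bs.
rewrite -/z in bz; rewrite bz !(bC _ z) !bz (bC y x) (bC w x) (bC w y); ring.
Qed.

Lemma symbil_comb2 (V : lmodType R) (b : V -> V -> R) (c d : R) (x y : V) :
  symmetric_bilinear b ->
  b (c *: x + d *: y) (c *: x + d *: y)
  = c ^+ 2 * b x x + d ^+ 2 * b y y + 2 * (c * d * b x y).
Proof.
move=> bs; have := symbil_comb c d 0 x y 0 bs.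
by rewrite /= scale0r addr0 => ->; ring.
Qed.

(** If [x] and [y] span a totally [G]-isotropic space, the segment from [y] to
[x] stays in the cone of [G], and [H] changes sign along it. *)
Lemma isotropic_segment (V : lmodType R) (G H : V -> V -> R) (x y : V) :
  symmetric_bilinear G -> symmetric_bilinear H ->
  G x x = 0 -> G y y = 0 -> G x y = 0 -> x != 0 -> y != 0 ->
  0 <= H x x -> H y y <= 0 ->
  exists2 z, z != 0 & G z z = 0 /\ H z z = 0.
Proof.
move=> Gs Hs Gx Gy Gxy x0 y0 Hx Hy.
have [Hy0|Hy0] := eqVneq (H y y) 0; first by exists y.
have Hylt : H y y < 0 by rewrite lt_neqAle Hy0.
pose p : {poly R} := 'X ^+ 2 * (H x x)%:P + (1 - 'X) ^+ 2 * (H y y)%:P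
  + 2%:P * ('X * (1 - 'X) * (H x y)%:P).
have pE t : p.[t] = let z := t *: x + (1 - t) *: y in H z z.
  by rewrite /= symbil_comb2 // /p !hornerE.
have [||t /andP[t0 t1] /rootP] := @poly_ivt R p 0 1; first exact: ler01.
  by rewrite !pE /= !scale0r scale1r add0r subr0 subrr scale1r scale0r addr0 Hx Hy.
rewrite pE /= => Hz; exists (t *: x + (1 - t) *: y); last first.
  by split=> //; rewrite symbil_comb2 // Gx Gy Gxy; ring.
(* if the segment meets 0 then y is a multiple of x, and H y y has the sign of
   H x x *)
have [t1E|t1N] := eqVneq t 1; first by rewrite t1E scale1r subrr scale0r addr0.
apply/eqP => z0.
have yE : y = (- (t / (1 - t))) *: x + 0 *: x.
  have t1' : 1 - t != 0 by rewrite subr_eq0 eq_sym.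
  apply: (scalerI t1'); rewrite scale0r addr0 scalerA.
  have -> : (1 - t) * - (t / (1 - t)) = - t by field.
  by apply/eqP; rewrite scaleNr -addr_eq0 addrC z0.
by move: Hylt; rewrite yE symbil_comb2 // mulr0 mul0r expr0n mul0r mulr0 !addr0
  ltNge mulr_ge0 ?sqr_ge0.
Qed.

(** On the span of [x], [y], [w] the cone of [G] is the nondegenerate conic
[2 c d (G x y) + e^2 (G w w) = 0] in the coordinates [c, d, e], so it has a
rational parametrisation, which runs from a multiple of [x] to a multiple of
[y]. *)
Lemma isotropic_conic (V : lmodType R) (G H : V -> V -> R) (x y w : V) :
  symmetric_bilinear G -> symmetric_bilinear H ->
  G x x = 0 -> G y y = 0 -> G x w = 0 -> G y w = 0 ->
  G x y != 0 -> G w w != 0 -> y != 0 ->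
  0 <= H x x -> H y y <= 0 ->
  exists2 z, z != 0 & G z z = 0 /\ H z z = 0.
Proof.
move=> Gs Hs Gx Gy Gxw Gyw pi0 sigma0 y0 Hx Hy.
set pi := G x y in pi0; set sigma := G w w in sigma0.
pose z (t : R) := (sigma * (1 - t) ^+ 2) *: x
  + ((- 2 * pi * t ^+ 2) *: y + (2 * pi * t * (1 - t)) *: w).
pose pc : {poly R} := sigma%:P * (1 - 'X) ^+ 2.
pose pd : {poly R} := (- 2 * pi)%:P * 'X ^+ 2.
pose pe : {poly R} := (2 * pi)%:P * 'X * (1 - 'X).
pose p : {poly R} := pc ^+ 2 * (H x x)%:P + pd ^+ 2 * (H y y)%:P
  + pe ^+ 2 * (H w w)%:P
  + 2%:P * (pc * pd * (H x y)%:P + pc * pe * (H x w)%:P + pd * pe * (H y w)%:P).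
have pE t : p.[t] = H (z t) (z t).
  by rewrite /z symbil_comb // /p /pc /pd /pe !hornerE.
have [||t /andP[t0 t1] /rootP] := @poly_ivt R (- p) 0 1; first exact: ler01.
  rewrite !hornerN !pE /z !symbil_comb // oppr_le0 oppr_ge0; apply/andP; split.
    rewrite [leRHS](_ : _ = sigma ^+ 2 * H x x) 1?mulr_ge0 // ?sqr_ge0 //; ring.
  rewrite [leLHS](_ : _ = (2 * pi) ^+ 2 * H y y) 1?mulr_ge0_le0 // ?sqr_ge0 //; ring.
rewrite hornerN => /eqP; rewrite oppr_eq0 pE => /eqP Hz; exists (z t); last first.
  by split=> //; rewrite symbil_comb // Gx Gy Gxw Gyw -/pi -/sigma; ring.
apply/eqP => z0.
(* pairing with y sees only the coefficient of x, so t = 1, where z is a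
   multiple of y *)
have Gz u : G (z t) u = sigma * (1 - t) ^+ 2 * G x u - 2 * pi * t ^+ 2 * G y u
   + 2 * pi * t * (1 - t) * G w u.
  by rewrite symbil_lin //; ring.
have := Gz y; rewrite z0 (symbil0 _ Gs) -/pi Gy (proj1 Gs w) Gyw !mulr0 subr0 addr0.
move=> /esym/eqP; rewrite !mulf_eq0 (negPf sigma0) (negPf pi0) orbF /= orbb subr_eq0.
move=> /eqP t1E; move: z0; rewrite /z -t1E subrr !expr2 !(mulr0, scale0r, mulr1, addr0, add0r).
move=> /eqP; rewrite scaler_eq0 (negPf y0) orbF mulf_eq0 (negPf pi0) orbF.
by rewrite oppr_eq0 pnatr_eq0.
Qed.

(** The space has room for a vector [w] that is [G]-orthogonal to both [x] and
[y]. If [G w w != 0], the conic joins [x] to [y]; otherwise [w] is isotropic and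
serves as a relay between two segments. In the plane, two isotropic lines may be
the whole cone and the statement fails. *)
Lemma quadratic_common_zero m (G H : 'rV[R]_m -> 'rV[R]_m -> R) (x y : 'rV[R]_m) :
  (2 < m)%N -> symmetric_bilinear G -> symmetric_bilinear H ->
  G x x = 0 -> G y y = 0 -> x != 0 -> y != 0 ->
  0 <= H x x -> H y y <= 0 ->
  exists2 z, z != 0 & G z z = 0 /\ H z z = 0.
Proof.
move=> m2 Gs Hs Gx Gy x0 y0 Hx Hy.
have [Gxy|Gxy] := eqVneq (G x y) 0; first exact: isotropic_segment Gxy x0 y0 Hx Hy.
have [w w0 [Gxw Gyw]] : exists2 w, w != 0 & G x w = 0 /\ G y w = 0.
  pose f (w : 'rV[R]_m) : 'rV[R]_(1 + 1) := row_mx (G w x)%:M (G w y)%:M.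
  have flin : linear f.
    move=> c u v; rewrite /f !(proj2 Gs) scale_row_mx add_row_mx.
    by rewrite !scale_scalar_mx !raddfD.
  have [w w0] := exists_kernel flin m2.
  rewrite /f -[0]row_mx0 => /eq_row_mx[/matrixP/(_ 0 0) fx /matrixP/(_ 0 0) fy].
  by exists w => //; rewrite !(proj1 Gs _ w); move: fx fy; rewrite !mxE.
have [Gw|Gw] := eqVneq (G w w) 0; last first.
  exact: isotropic_conic Gxw Gyw Gxy Gw y0 Hx Hy.
(* relay: H changes sign either between x and w or between w and y *)
have [Hw|/ltW Hw] := leP (H w w) 0.
  exact: isotropic_segment Gxw x0 w0 Hx Hw.
by apply: (isotropic_segment Gs Hs Gw Gy) Hw Hy; rewrite ?(proj1 Gs w).
Qed.

(** Turning the pair [(x, y)] inside its span to an angle at which [G] takes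
equal values on both vectors keeps the sums of [G] and of [H]; of the two turned
vectors, scaled by [sqrt 2], the one with the smaller [H] will do. *)
Lemma quadratic_sum (V : lmodType R) (G H : V -> V -> R) (x y : V) :
  symmetric_bilinear G -> symmetric_bilinear H ->
  exists z, G z z = G x x + G y y /\ H z z <= H x x + H y y.
Proof.
move=> Gs Hs.
(* (c, d) is an unnormalised direction along which G takes its mean value; it
   solves a quadratic equation with nonnegative discriminant *)
have [c [d [cd0 Gcd]]] : exists c d : R, 0 < c ^+ 2 + d ^+ 2 /\
    (c ^+ 2 - d ^+ 2) * (G x x - G y y) + 4 * (c * d * G x y) = 0.
  have [g0|g0] := eqVneq (G x x - G y y) 0.
    by exists 1, 0; split; [rewrite expr1n expr0n addr0 ltr01|rewrite g0; ring].
  pose g := G x x - G y y; pose b := G x y.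
  pose s := Num.sqrt (4 * b ^+ 2 + g ^+ 2).
  have s2 : s ^+ 2 = 4 * b ^+ 2 + g ^+ 2.
    by rewrite sqr_sqrtr // addr_ge0 ?sqr_ge0 // mulr_ge0 ?sqr_ge0 // ler0n.
  exists (s - 2 * b), g; split.
    by rewrite ltr_wpDl ?sqr_ge0 // exprn_even_gt0.
  rewrite -/g -/b; have -> : (s - 2 * b) ^+ 2 = s ^+ 2 - 4 * b * s + 4 * b ^+ 2 by ring.
  by rewrite s2; ring.
pose k := Num.sqrt (2 / (c ^+ 2 + d ^+ 2)).
have k2 : k ^+ 2 = 2 / (c ^+ 2 + d ^+ 2) by rewrite sqr_sqrtr // divr_ge0 // ltW.
have cdN : c ^+ 2 + d ^+ 2 != 0 by rewrite gt_eqF.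
have Gz (a e : R) : a ^+ 2 + e ^+ 2 = c ^+ 2 + d ^+ 2 ->
    (a ^+ 2 - e ^+ 2) * (G x x - G y y) + 4 * (a * e * G x y) = 0 ->
    G ((k * a) *: x + (k * e) *: y) ((k * a) *: x + (k * e) *: y) = G x x + G y y.
  move=> ae Gae; rewrite symbil_comb2 //.
  rewrite (_ : _ + _ = k ^+ 2 * (((a ^+ 2 + e ^+ 2) * (G x x + G y y)
    + ((a ^+ 2 - e ^+ 2) * (G x x - G y y) + 4 * (a * e * G x y))) / 2)); last by field.
  by rewrite Gae ae k2; field.
have Hsum : H ((k * c) *: x + (k * d) *: y) ((k * c) *: x + (k * d) *: y)
   + H ((k * - d) *: x + (k * c) *: y) ((k * - d) *: x + (k * c) *: y)
   = 2 * (H x x + H y y).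
  rewrite !symbil_comb2 //.
  rewrite (_ : _ + _ = k ^+ 2 * ((c ^+ 2 + d ^+ 2) * (H x x + H y y))); last by ring.
  by rewrite k2; field.
have [le1|lt1] := leP (H ((k * c) *: x + (k * d) *: y) ((k * c) *: x + (k * d) *: y))
    (H x x + H y y).
  by exists ((k * c) *: x + (k * d) *: y); rewrite Gz.
exists ((k * - d) *: x + (k * c) *: y); rewrite Gz; [split=> //; lra|ring|].
by rewrite -[RHS]oppr0 -Gcd; ring.
Qed.
End Forms.

(** * Rotations *)

Lemma SO_intro (R : realType) n (U : 'M[R]_n) :
  U^T *m U = 1%:M -> 0 < \det U -> @SO R n U.
Proof. by move=> UU detU; split=> //; apply: mulmx1C. Qed.

Lemma SO_mul (R : realType) n (U V : 'M[R]_n) :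
  @SO R n U -> @SO R n V -> @SO R n (U *m V).
Proof.
move=> [UU _ dU] [VV _ dV]; apply: SO_intro; last by rewrite det_mulmx mulr_gt0.
by rewrite trmx_mul mulmxA -(mulmxA V^T) UU mulmx1.
Qed.

Lemma SO_1 (R : realType) n : @SO R n 1%:M.
Proof. by apply: SO_intro; rewrite ?trmx1 ?mulmx1 // det1 ltr01. Qed.

Lemma SO_conj (R : realType) n (Q U : 'M[R]_n) :
  Q^T *m Q = 1%:M -> @SO R n U -> @SO R n (Q *m U *m Q^T).
Proof.
move=> QQ [UU _ dU]; have QQ' := mulmx1C QQ; apply: SO_intro.
  rewrite !trmx_mul trmxK !mulmxA -(mulmxA (Q *m U^T)) QQ mulmx1.
  by rewrite -(mulmxA Q) UU mulmx1 QQ'.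
by rewrite !det_mulmx mulrC mulrA -det_mulmx QQ det1 mul1r.
Qed.

Lemma SO_block (R : realType) m n (U : 'M[R]_m) (V : 'M[R]_n) :
  @SO R m U -> @SO R n V -> @SO R (m + n) (block_mx U 0 0 V).
Proof.
move=> [UU _ dU] [VV _ dV]; apply: SO_intro; last by rewrite det_ublock mulr_gt0.
by rewrite tr_block_mx mulmx_block !trmx0 !(mulmx0, mul0mx, addr0, add0r) UU VV
  -scalar_mx_block.
Qed.

(** With [a = cos t] and [s = sin t], the matrix is the square of the orthogonal
[cos (t / 2) + sin (t / 2) J], hence its determinant is positive. *)
Lemma SO_complex_rotation (R : realType) n (J : 'M[R]_n) (a : R) :
  J^T = - J -> J *m J = - 1%:M -> 0 <= a <= 1 ->
  exists s, @SO R n (a *: 1%:M + s *: J).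
Proof.
move=> JT JJ /andP[a0 a1].
pose c := Num.sqrt ((1 + a) / 2); pose d := Num.sqrt ((1 - a) / 2).
have c2 : c ^+ 2 = (1 + a) / 2 by rewrite sqr_sqrtr //; lra.
have d2 : d ^+ 2 = (1 - a) / 2 by rewrite sqr_sqrtr //; lra.
have mulJ (p q r t : R) : (p *: 1%:M + q *: J) *m (r *: 1%:M + t *: J)
    = (p * r - q * t) *: 1%:M + (p * t + q * r) *: J.
  rewrite mulmxDl !mulmxDr -!scalemxAl -!scalemxAr !mulmx1 !mul1mx JJ.
  rewrite !scalerA scalerN [RHS](_ : _ = (p * r) *: 1%:M - (q * t) *: 1%:M
    + ((p * t) *: J + (q * r) *: J)); last by rewrite scalerBl scalerDl.
  by rewrite -!addrA; congr (_ + _);  rewrite addrA addrC.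
pose V := c *: 1%:M + d *: J.
have VV : V^T *m V = 1%:M.
  have -> : V^T = c *: 1%:M + (- d) *: J.
    by rewrite /V linearD !linearZ /= trmx1 JT scalerN scaleNr.
  rewrite mulJ.
  have -> : c * c - - d * d = 1 by rewrite mulNr opprK -!expr2 c2 d2; field.
  by rewrite mulNr mulrC addrN scale0r scale1r addr0.
have detV : \det V != 0.
  apply/eqP => V0; have := congr1 determinant VV.
  by rewrite det_mulmx V0 mulr0 det1 => /esym/eqP; rewrite oner_eq0.
exists (c * d + d * c); have -> : a = c * c - d * d by rewrite -!expr2 c2 d2; field.
rewrite -mulJ -/V; apply: SO_intro; last first.
  by rewrite det_mulmx -expr2 exprn_even_gt0.
by rewrite trmx_mul mulmxA -(mulmxA V^T) VV mulmx1.
Qed.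

(** * Scaling the image of the identity *)

(** Star-shapedness at the identity matrix only: by absorbing an orbit element
into [L], this covers every orbit. *)
Definition shrinks (R : realType) n :=
  forall (L : {linear 'M[R]_n -> 'rV[R]_2}) (a : R), 0 <= a <= 1 ->
  exists2 U, @SO R n U & L U = a *: L 1%:M.

Lemma shrink_along_complex_structure (R : realType) n (J : 'M[R]_n)
    (L : {linear 'M[R]_n -> 'rV[R]_2}) (a : R) :
  J^T = - J -> J *m J = - 1%:M -> L J = 0 -> 0 <= a <= 1 ->
  exists2 U, @SO R n U & L U = a *: L 1%:M.
Proof.
move=> JT JJ LJ a01; have [s Us] := SO_complex_rotation JT JJ a01.
by exists (a *: 1%:M + s *: J) => //; rewrite linearD !linearZ /= LJ scaler0 addr0.
Qed.

Definition ulblock (R : realType) m n (X : 'M[R]_m) : 'M[R]_(m + n) :=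
  block_mx X 0 0 0.
Definition drblock (R : realType) m n (X : 'M[R]_n) : 'M[R]_(m + n) :=
  block_mx 0 0 0 X.

Lemma ulblock_linear (R : realType) m n : linear (@ulblock R m n).
Proof.
by move=> c X Y; rewrite /ulblock scale_block_mx add_block_mx !scaler0 !addr0.
Qed.
HB.instance Definition _ (R : realType) m n :=
  GRing.isLinear.Build R 'M[R]_m 'M[R]_(m + n) _ (@ulblock R m n)
    (@ulblock_linear R m n).
Lemma drblock_linear (R : realType) m n : linear (@drblock R m n).
Proof.
by move=> c X Y; rewrite /drblock scale_block_mx add_block_mx !scaler0 !addr0.
Qed.
HB.instance Definition _ (R : realType) m n :=
  GRing.isLinear.Build R 'M[R]_n 'M[R]_(m + n) _ (@drblock R m n)
    (@drblock_linear R m n).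

Lemma block_diagE (R : realType) m n (X : 'M[R]_m) (Y : 'M[R]_n) :
  block_mx X 0 0 Y = ulblock n X + drblock m Y.
Proof. by rewrite /ulblock /drblock add_block_mx !addr0 !add0r. Qed.

(** The first block may have size 2, where [shrinks] fails since [L] can map the
circle of rotations onto an ellipse; there [U] exists for special [L] only. *)
Lemma shrink_block (R : realType) m n (L : {linear 'M[R]_(m + n) -> 'rV[R]_2})
    (a : R) (U : 'M[R]_m) :
  shrinks R n -> 0 <= a <= 1 -> @SO R m U ->
  L (ulblock n U) = a *: L (ulblock n 1%:M) ->
  exists2 W, @SO R (m + n) W & L W = a *: L 1%:M.
Proof.
move=> shn a01 soU LU.
have [V soV /= LV] := shn (L \o @drblock R m n) a a01.
exists (block_mx U 0 0 V); first exact: SO_block.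
by rewrite (scalar_mx_block m n) !block_diagE !linearD /= LU LV.
Qed.

Lemma shrinksD (R : realType) m n :
  shrinks R m -> shrinks R n -> shrinks R (m + n).
Proof.
move=> shm shn L a a01; have [U soU /= LU] := shm (L \o @ulblock R m n) a a01.
exact: shrink_block LU.
Qed.

(** * Dimension four: quaternions *)

(** Left multiplication by the quaternion [a + b i + c j + d k] in the basis
[1, i, j, k]. *)
Definition quat_lmul (R : realType) (q : 'rV[R]_4) : 'M[R]_4 :=
  let a := q 0 0 in let b := q 0 1 in let c := q 0 2 in let d := q 0 3 in
  \matrix_(i, j)
    nth 0 (nth [::] [:: [:: a; - b; - c; - d];
                        [:: b;   a; - d;   c];
                        [:: c;   d;   a; - b];
                        [:: d; - c;   b;   a]] i) j.

Ltac ord4_cases i := case: i => [[|[|[|[|//]]]] ?] //.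

Lemma quat_lmul_linear (R : realType) : linear (@quat_lmul R).
Proof.
move=> k x y; apply/matrixP => i j; ord4_cases i; ord4_cases j; rewrite !mxE /=; ring.
Qed.
HB.instance Definition _ (R : realType) :=
  GRing.isLinear.Build R 'rV[R]_4 'M[R]_4 _ (@quat_lmul R) (@quat_lmul_linear R).

Definition dot (R : realType) m (x y : 'rV[R]_m) : R := (x *m y^T) 0 0.

Lemma dot4 (R : realType) (x y : 'rV[R]_4) :
  dot x y = x 0 0 * y 0 0 + x 0 1 * y 0 1 + x 0 2 * y 0 2 + x 0 3 * y 0 3.
Proof.
rewrite /dot !mxE !big_ord_recl big_ord0 addr0 !mxE !addrA.
by congr (_ + _ + _ + _); congr (x 0 _ * y 0 _); apply/val_inj.
Qed.

Lemma quat_lmul_norm (R : realType) (q : 'rV[R]_4) :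
  (quat_lmul q)^T *m quat_lmul q = (dot q q)%:M.
Proof.
apply/matrixP => i j; rewrite dot4 mxE !big_ord_recl big_ord0 !mxE.
ord4_cases i; ord4_cases j; rewrite /=; ring.
Qed.

(** Together with [quat_lmul_norm]: left multiplication by a unit imaginary
quaternion is a complex structure. *)
Lemma quat_lmul_tr (R : realType) (q : 'rV[R]_4) :
  q 0 0 = 0 -> (quat_lmul q)^T = - quat_lmul q.
Proof.
move=> q0; apply/matrixP => i j; ord4_cases i; ord4_cases j; rewrite !mxE /= ?q0; ring.
Qed.

Lemma dot_gt0 (R : realType) m (x : 'rV[R]_m) : x != 0 -> 0 < dot x x.
Proof.
move=> x0; rewrite /dot mxE lt_neqAle sumr_ge0 => [|i _]; last first.
  by rewrite mxE -expr2 sqr_ge0.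
rewrite andbT eq_sym psumr_eq0 => [|i _]; last by rewrite mxE -expr2 sqr_ge0.
apply: contra x0 => /allP h; apply/eqP/rowP => i; rewrite mxE.
by apply/eqP; have := h i (mem_index_enum _); rewrite mxE -expr2 expf_eq0.
Qed.

Lemma exists_unit_kernel (R : realType) m k (f : 'rV[R]_m -> 'rV[R]_k) :
  linear f -> (k < m)%N -> exists2 w, dot w w = 1 & f w = 0.
Proof.
move=> flin km; have [w w0 fw] := exists_kernel flin km.
have w2 := dot_gt0 w0; pose s := Num.sqrt (dot w w).
have s0 : s != 0 by rewrite gt_eqF // sqrtr_gt0.
exists (s^-1 *: w).
  have -> : dot (s^-1 *: w) (s^-1 *: w) = s^-1 * (s^-1 * dot w w).
    by rewrite /dot linearZ /= -scalemxAl -scalemxAr; move: (_ *m _) => M; rewrite !mxE.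
  by rewrite -[dot w w]sqr_sqrtr ?ltW // -/s; field.
have f0 : f 0 = 0.
  by apply: (addrI (f 0)); have := flin 1 0 0; rewrite !scale1r !addr0 => <-.
by have := flin s^-1 w 0; rewrite fw f0 !addr0 scaler0.
Qed.

(** The vanishing of the real part and of [L] are three linear conditions on four
coordinates. *)
Lemma shrinks4 (R : realType) : shrinks R 4.
Proof.
move=> L a a01.
pose f (q : 'rV[R]_4) : 'rV[R]_(1 + 2) := row_mx (q 0 0)%:M (L (quat_lmul q)).
have flin : linear f.
  move=> c u v; rewrite /f !linearP /= scale_row_mx add_row_mx !mxE.
  by rewrite scale_scalar_mx !raddfD.
have [q qq fq] := exists_unit_kernel flin (isT : 3 < 4)%N.
have /eq_row_mx[/matrixP/(_ 0 0) q0 Lq] : f q = row_mx 0 0 by rewrite row_mx0.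
have {}q0 : q 0 0 = 0 by move: q0; rewrite !mxE.
apply: shrink_along_complex_structure Lq a01; first exact: quat_lmul_tr.
by rewrite -[X in X *m _]opprK -(quat_lmul_tr q0) mulNmx quat_lmul_norm qq.
Qed.

(** * Dimension three: two quadratic forms on the quaternions *)

(** The polarisation of [q |-> (v |-> q v (conj q))] on imaginary
quaternions: its diagonal is the Euler-Rodrigues parametrisation. *)
Definition rot (R : realType) (x y : 'rV[R]_4) : 'M[R]_3 :=
  let a := x 0 0 in let b := x 0 1 in let c := x 0 2 in let d := x 0 3 in
  let a' := y 0 0 in let b' := y 0 1 in let c' := y 0 2 in let d' := y 0 3 in
  \matrix_(i, j)
    nth 0 (nth [::]
      [:: [:: a * a' + b * b' - c * c' - d * d';
              b * c' + c * b' - a * d' - d * a';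
              b * d' + d * b' + a * c' + c * a'];
          [:: b * c' + c * b' + a * d' + d * a';
              a * a' - b * b' + c * c' - d * d';
              c * d' + d * c' - a * b' - b * a'];
          [:: b * d' + d * b' - a * c' - c * a';
              c * d' + d * c' + a * b' + b * a';
              a * a' - b * b' - c * c' + d * d']] i) j.

Lemma rotC (R : realType) (x y : 'rV[R]_4) : rot x y = rot y x.
Proof.
apply/matrixP => i j; ord4_cases i; ord4_cases j; rewrite !mxE /=; ring.
Qed.

Lemma rot_linear (R : realType) k (x y z : 'rV[R]_4) :
  rot (k *: x + y) z = k *: rot x z + rot y z.
Proof.
apply/matrixP => i j; ord4_cases i; ord4_cases j; rewrite !mxE /=; ring.
Qed.

Lemma rot_tr_mul (R : realType) (q : 'rV[R]_4) :
  (rot q q)^T *m rot q q = (dot q q ^+ 2)%:M.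
Proof.
apply/matrixP => i j; rewrite dot4 mxE !big_ord_recl big_ord0 !mxE.
ord4_cases i; ord4_cases j; rewrite /=; ring.
Qed.

Lemma det_rot (R : realType) (q : 'rV[R]_4) : \det (rot q q) = dot q q ^+ 3.
Proof.
rewrite dot4 (expand_det_row _ 0) !big_ord_recl big_ord0 /cofactor.
rewrite !(expand_det_row _ 0) !big_ord_recl !big_ord0 /cofactor !det_mx11 !mxE /=.
ring.
Qed.

Lemma SO_rot (R : realType) (q : 'rV[R]_4) :
  q != 0 -> @SO R 3 ((dot q q)^-1 *: rot q q).
Proof.
move=> /dot_gt0 qq; have qN : dot q q != 0 by rewrite gt_eqF.
apply: SO_intro.
  rewrite [(_ *: _)^T]linearZ -scalemxAl -scalemxAr rot_tr_mul scalerA scale_scalar_mx.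
  by congr (_%:M); field.
by rewrite detZ det_rot mulr_gt0 // exprn_gt0 // invr_gt0.
Qed.

Lemma rot_e0 (R : realType) : rot 'e_0 'e_0 = 1%:M :> 'M[R]_3.
Proof.
apply/matrixP => i j; ord4_cases i; ord4_cases j; rewrite !mxE /=; ring.
Qed.

(** The half turns about the three coordinate axes are the diagonal rotations
other than the identity. *)
Lemma rot_basis (R : realType) :
  rot 'e_1 'e_1 + rot 'e_2 'e_2 + rot 'e_3 'e_3 = - 1%:M :> 'M[R]_3.
Proof.
apply/matrixP => i j; ord4_cases i; ord4_cases j; rewrite !mxE /=; ring.
Qed.

(** [G] vanishes when [L (rot q q)] is parallel to [v = L 1], and then [H]
vanishes when the factor is [a |q|^2]. *)
Lemma shrinks3 (R : realType) : shrinks R 3.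
Proof.
move=> L a /andP[a0 a1]; set v := L 1%:M.
have [vE|vN] := eqVneq v 0.
  by exists 1%:M; [exact: SO_1|rewrite -/v vE scaler0].
have N0 := dot_gt0 vN; set N := dot v v in N0.
have dot2 (x y : 'rV[R]_2) : dot x y = x 0 0 * y 0 0 + x 0 1 * y 0 1.
  rewrite /dot !mxE !big_ord_recl big_ord0 addr0 !mxE.
  by congr (_ + _); congr (x 0 _ * y 0 _); apply/val_inj.
pose g (u : 'rV[R]_2) := v 0 0 * u 0 1 - v 0 1 * u 0 0.
pose G (x y : 'rV[R]_4) := g (L (rot x y)).
pose H (x y : 'rV[R]_4) := dot v (L (rot x y)) - a * N * dot x y.
have Gs : symmetric_bilinear G.
  split=> [x y|c x y z]; rewrite /G /g; first by rewrite rotC.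
  by rewrite rot_linear linearP !mxE; ring.
have Hs : symmetric_bilinear H.
  split=> [x y|c x y z]; rewrite /H !dot2 !dot4; first by rewrite rotC; ring.
  by rewrite rot_linear linearP !mxE; ring.
have Lbasis : L (rot 'e_1 'e_1) + L (rot 'e_2 'e_2) + L (rot 'e_3 'e_3) = - v.
  by rewrite -!linearD rot_basis linearN.
have Lb i := congr1 (fun u : 'rV[R]_2 => u 0 i) Lbasis.
have dote (i : 'I_4) : dot 'e_i 'e_i = 1 :> R.
  by rewrite /dot trmx_delta mul_delta_mx mxE eqxx.
(* merging e_1, e_2, e_3 gives G y y = 0 and H y y <= - (1 + 3 a) |v|^2 *)
have [z [Gz Hz]] := quadratic_sum 'e_1 'e_2 Gs Hs.
have [y [Gy Hy]] := quadratic_sum z 'e_3 Gs Hs.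
have Gy0 : G y y = 0.
  rewrite Gy Gz /G /g; have := Lb 0; have := Lb 1; rewrite !mxE => h1 h0.
  by have := congr1 ( *%R (v 0 0)) h1; have := congr1 ( *%R (v 0 1)) h0; lra.
have Hy0 : H y y < 0.
  apply: le_lt_trans Hy _; apply: (@le_lt_trans _ _ (- N - 3 * (a * N))).
    rewrite (le_trans (lerD Hz (lexx _))) // /H !dote /N !dot2.
    have := Lb 0; have := Lb 1; rewrite !mxE => h1 h0.
    by have := congr1 ( *%R (v 0 0)) h0; have := congr1 ( *%R (v 0 1)) h1; lra.
  by have := mulr_ge0 a0 (ltW N0); lra.
have y0 : y != 0.
  by apply: contraTneq Hy0 => ->; rewrite (symbil0 _ Hs) ltxx.
have e00 : 'e_0 != 0 :> 'rV[R]_4.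
  apply: contraTneq (ltr01 : 0 < 1 :> R) => e0.
  by rewrite -(dote 0) e0 /dot mul0mx mxE ltxx.
have Ge : G 'e_0 'e_0 = 0 by rewrite /G rot_e0 /g -/v mulrC subrr.
have He : 0 <= H 'e_0 'e_0.
  rewrite /H rot_e0 -/v -/N dote mulr1 subr_ge0; nra.
have [q q0 [Gq Hq]] :=
  quadratic_common_zero (isT : (2 < 4)%N) Gs Hs Ge Gy0 e00 y0 He (ltW Hy0).
exists ((dot q q)^-1 *: rot q q); first exact: SO_rot.
have qq := dot_gt0 q0.
rewrite linearZ /=.
move: Gq Hq; rewrite /G /H /g; move: (L (rot q q)) => u Gq Hq.
have -> : u = (a * dot q q) *: v.
  have {}Gq : v 0 0 * u 0 1 = v 0 1 * u 0 0 by lra.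
  have {}Hq : dot v u = a * N * dot q q by lra.
  (* u is its own projection on v *)
  have Nu i : N * u 0 i = dot v u * v 0 i.
    rewrite /N !dot2; case: i => [[|[|//]] i2].
      rewrite (_ : Ordinal i2 = 0); last exact/val_inj.
      by have := congr1 ( *%R (v 0 1)) Gq; lra.
    rewrite (_ : Ordinal i2 = 1); last exact/val_inj.
    by have := congr1 ( *%R (v 0 0)) Gq; lra.
  apply/rowP => i; apply: (mulfI (lt0r_neq0 N0)).
  by rewrite Nu Hq !mxE; ring.
by rewrite scalerA; congr (_ *: _); field; rewrite gt_eqF.
Qed.

(** * Dimension five: a plane killed by the map, and its complement *)

Lemma shrink_conj (R : realType) n (Q : 'M[R]_n)
    (L : {linear 'M[R]_n -> 'rV[R]_2}) (a : R) :
  Q^T *m Q = 1%:M ->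
  (exists2 U, @SO R n U & L (Q *m U *m Q^T) = a *: L (Q *m 1%:M *m Q^T)) ->
  exists2 U, @SO R n U & L U = a *: L 1%:M.
Proof.
move=> QQ [U soU LU]; exists (Q *m U *m Q^T); first exact: SO_conj.
by rewrite LU mulmx1 (mulmx1C QQ).
Qed.

Definition skew2 (R : realType) : 'M[R]_(1 + 1) :=
  block_mx 0 (- 1%:M : 'M_1) (1%:M : 'M_1) 0.

Lemma skew2_sqr (R : realType) : skew2 R *m skew2 R = - 1%:M.
Proof.
rewrite /skew2 mulmx_block !(mulmx0, mul0mx, mulmx1, mul1mx, addr0, add0r).
by rewrite (scalar_mx_block 1 1) opp_block_mx !oppr0.
Qed.

Lemma skew2_tr (R : realType) : (skew2 R)^T = - skew2 R.
Proof.
by rewrite /skew2 tr_block_mx opp_block_mx !trmx0 linearN /= trmx1 opprK oppr0.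
Qed.

(** The quarter turn of the plane of the first two coordinates, seen in the
splitting 1 + 4: there a change of basis of the last four coordinates acts on
each block separately. *)
Lemma ulblock_skew2 (R : realType) :
  ulblock 3 (skew2 R) =
  block_mx (0 : 'M_1) (- ('e_0 : 'rV[R]_(1 + 3)))
    ('e_0 : 'rV[R]_(1 + 3))^T (0 : 'M_(1 + 3)).
Proof.
have -> : 'e_0 = row_mx (1%:M : 'M_1) 0 :> 'rV[R]_(1 + 3).
  apply/rowP => i; rewrite !mxE; case: splitP => k ik; rewrite !mxE -!val_eqE /= ik.
    by rewrite !ord1.
  by [].
rewrite tr_row_mx opp_row_mx trmx1 trmx0 oppr0 -block_mx0.
by rewrite block_mxA castmx_id col_mx0 row_mx0.
Qed.

(** So [quat_lmul] completes every unit vector to an orthonormal basis. *)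
Lemma quat_lmul_col0 (R : realType) (y : 'rV[R]_4) : quat_lmul y *m ('e_0)^T = y^T.
Proof.
apply/colP => i; rewrite mxE !big_ord_recl big_ord0 !mxE /=.
ord4_cases i; rewrite /= !(mulr0, mulr1, addr0); congr (y 0 _); exact/val_inj.
Qed.

(** Among the planes through the first basis vector and a vector [y] of its
4-dimensional complement, [L] kills the quarter turn of some. Conjugation by [Q]
moves this plane to the first two coordinates. *)
Lemma shrinks5 (R : realType) : shrinks R 5.
Proof.
move=> L a a01.
pose cross (y : 'rV[R]_4) : 'M[R]_(1 + 4) := block_mx 0 (- y) y^T 0.
have cross_lin c u v : cross (c *: u + v) = c *: cross u + cross v.
  rewrite /cross scale_block_mx add_block_mx !scaler0 !addr0.
  by rewrite !linearP.
have flin : linear (L \o cross) by move=> c u v /=; rewrite cross_lin linearP.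
have [y yy fy] := exists_unit_kernel flin (isT : 2 < 4)%N.
pose Q : 'M[R]_(1 + 4) := block_mx 1%:M 0 0 (quat_lmul y).
have QQ : Q^T *m Q = 1%:M.
  rewrite /Q tr_block_mx mulmx_block !trmx0 !(mulmx0, mul0mx, addr0, add0r).
  by rewrite quat_lmul_norm yy trmx1 mulmx1 -scalar_mx_block.
apply: (shrink_conj QQ).
pose L' : {linear 'M[R]_(2 + 3) -> 'rV[R]_2} := L \o (mulmxr Q^T \o mulmx Q).
have QJ : Q *m block_mx 0 (- 'e_0) ('e_0)^T 0 *m Q^T = cross y.
  rewrite /Q tr_block_mx !mulmx_block !trmx0 !(mulmx0, mul0mx, addr0, add0r).
  rewrite trmx1 !(mulmx1, mul1mx) quat_lmul_col0 mulNmx; congr (block_mx 0 (- _) _ 0).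
  by apply: trmx_inj; rewrite trmx_mul trmxK quat_lmul_col0.
have LJ : L' (ulblock 3 (skew2 R)) = 0.
  by rewrite -[RHS]fy /= ulblock_skew2; congr (L _); exact: QJ.
have [U soU LU] := shrink_along_complex_structure
  (L := L' \o @ulblock R 2 3) (skew2_tr R) (skew2_sqr R) LJ a01.
have [W soW LW] := shrink_block (L := L') (@shrinks3 R) a01 soU LU.
by exists W.
Qed.

(** * Assembling the blocks *)

Lemma shrinks_ge3 (R : realType) n : shrinks R n.+3.
Proof.
suff: [/\ shrinks R n.+3, shrinks R n.+4 & shrinks R n.+4.+1] by case.
elim: n => [|n [sh3 sh4 sh5]].
  by split; [exact: shrinks3|exact: shrinks4|exact: shrinks5].
by split=> //; exact: (shrinksD (@shrinks3 R) sh3).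
Qed.

Theorem theorem2p7 (R : realType) (n : nat) (hn : (3 <= n)%N) (A : 'M[R]_n)
    (L : {linear 'M[R]_n -> 'rV[R]_2}) :
  star_shaped (L @` so_orbit A) 0.
Proof.
have shn : shrinks R n by case: n hn {A L} => [|[|[|n]]] // _; apply: shrinks_ge3.
have shrink (a : R) B : 0 <= a <= 1 -> so_orbit A B -> (L @` so_orbit A) (a *: L B).
  move=> a01 [U soU [V soV <-]].
  have [W soW /= LW] := shn (L \o mulmxr (U *m A *m V)) a a01.
  exists (W *m (U *m A *m V)); last by rewrite LW mul1mx.
  exists (W *m U); first exact: SO_mul.
  by exists V; rewrite // !mulmxA.
split=> [|a _ a01 [B AB <-]]; last by rewrite scaler0 addr0; apply: shrink.
rewrite -(scale0r (L A)); apply: shrink; first by rewrite lexx ler01.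
by exists 1%:M; [exact: SO_1|exists 1%:M; [exact: SO_1|rewrite mul1mx mulmx1]].
Qed.
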